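(* Let $\mathcal X,\mathcal Y$ be finite sets, $\mu=\mu_1\times\mu_2$ a product distribution on $\mathcal X\times\mathcal Y$, and $f:\mathcal X\times\mathcal Y\to\{0,1\}$ with $\mathrm{IC}^{\mathrm{ext}}_\mu(f,0)>0$. Let $\delta=\min\{\mu(f^{-1}(0)),\mu(f^{-1}(1))\}$ (then $\delta>0$). Then for all $0<\epsilon<1/2$, \[ \mathrm{IC}^{\mathrm{ext}}_\mu(f,0)-\mathrm{IC}^{\mathrm{ext}}_\mu(f,\epsilon)\ge\frac{1-\sqrt{1-\delta}}{4}\,h(\epsilon)+\frac{\epsilon}{2}\,\mathrm{IC}^{\mathrm{ext}}_\mu(f,0). \]
   Context: $h$ is the binary entropy function (logs base 2). Two-party communication model: Alice gets $x$, Bob gets $y$; protocols may use public and private randomness; the transcript $\Pi$ consists of the public random string and all transmitted bits; the output $\pi(x,y)$ is determined by the transcript. For $(X,Y)\sim\mu$, $\mathrm{IC}^{\mathrm{ext}}_\mu(\pi)=I(\Pi;XY)$. A protocol performs $[f,\eta]$ if $\Pr[\pi(x,y)\ne f(x,y)]\le\eta$ for every $(x,y)$; $\mathrm{IC}^{\mathrm{ext}}_\mu(f,\eta)=\inf\{\mathrm{IC}^{\mathrm{ext}}_\mu(\pi):\pi\text{ performs }[f,\eta]\}$. *)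

(* Defs.v *)
From Stdlib Require Import Reals.
From mathcomp Require Import all_boot.
Set Implicit Arguments. Unset Strict Implicit. Unset Printing Implicit Defensive.

Local Open Scope R_scope.

Definition log2 (a : R) : R := ln a / ln 2.

Definition hbin (e : R) : R := - (e * log2 e) - (1 - e) * log2 (1 - e).

Definition is_dist (T : finType) (m : T -> R) : Prop :=
  (forall t, 0 <= m t) /\ \big[Rplus/0]_(t : T) m t = 1.

Definition is_inf (E : R -> Prop) (m : R) : Prop :=
  (forall v, E v -> m <= v) /\ (forall b, (forall v, E v -> b <= v) -> b <= m).

Section Protocols.
Variables (X Y : finType).

(* A private-coin protocol tree: at an Alice node, Alice (knowing x) sends the
   bit 1 with probability [p x] (and 0 with probability 1 - p x); the
   dependence on the history is through the position in the tree; similarly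
   for Bob.  Leaves carry the output. *)
Inductive ptree : Type :=
| PLeaf : bool -> ptree
| PAlice : (X -> R) -> ptree -> ptree -> ptree
| PBob : (Y -> R) -> ptree -> ptree -> ptree.

Fixpoint ptree_valid (t : ptree) : Prop :=
  match t with
  | PLeaf _ => True
  | PAlice p t0 t1 => (forall x, 0 <= p x <= 1) /\ ptree_valid t0 /\ ptree_valid t1
  | PBob q t0 t1 => (forall y, 0 <= q y <= 1) /\ ptree_valid t0 /\ ptree_valid t1
  end.

(* leaves: (transmitted bits, output, Pr[reach this leaf | x, y]) *)
Fixpoint leaves (t : ptree) : seq (seq bool * bool * (X -> Y -> R)) :=
  match t with
  | PLeaf b => [:: ([::], b, fun _ _ => 1)]
  | PAlice p t0 t1 =>
      [seq (false :: l.1.1, l.1.2, fun x y => (1 - p x) * l.2 x y) | l <- leaves t0]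
   ++ [seq (true :: l.1.1, l.1.2, fun x y => p x * l.2 x y) | l <- leaves t1]
  | PBob q t0 t1 =>
      [seq (false :: l.1.1, l.1.2, fun x y => (1 - q y) * l.2 x y) | l <- leaves t0]
   ++ [seq (true :: l.1.1, l.1.2, fun x y => q y * l.2 x y) | l <- leaves t1]
  end.

(* A (public + private coin) protocol: the public random string r ranges over
   {0, ..., size P - 1}, has probability (nth r P).1, and then the private-coin
   protocol (nth r P).2 is run. *)
Definition protocol := seq (R * ptree).

Definition protocol_valid (P : protocol) : Prop :=
  (forall r, (r < size P)%N -> 0 <= (nth (0, PLeaf false) P r).1)
  /\ \big[Rplus/0]_(c <- map fst P) c = 1
  /\ (forall r, (r < size P)%N -> ptree_valid (nth (0, PLeaf false) P r).2).

(* Transcripts = (public string, transmitted bits), with output and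
   Pr[transcript | x, y]. *)
Definition atoms (P : protocol) : seq (nat * seq bool * bool * (X -> Y -> R)) :=
  flatten [seq [seq (r, l.1.1, l.1.2,
                      fun x y => (nth (0, PLeaf false) P r).1 * l.2 x y)
               | l <- leaves (nth (0, PLeaf false) P r).2]
          | r <- iota 0 (size P)].

Definition perr (P : protocol) (f : X -> Y -> bool) (x : X) (y : Y) : R :=
  \big[Rplus/0]_(a <- atoms P | a.1.2 != f x y) a.2 x y.

Definition performs (P : protocol) (f : X -> Y -> bool) (eta : R) : Prop :=
  forall x y, perr P f x y <= eta.

(* Pr[Pi = tau] for a transcript with conditional probability w *)
Definition tprob (mu : X -> Y -> R) (w : X -> Y -> R) : R :=
  \big[Rplus/0]_(x : X) \big[Rplus/0]_(y : Y) (mu x y * w x y).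

(* external information cost I(Pi ; XY) under (X,Y) ~ mu, with 0 log 0 = 0 *)
Definition ic_ext (mu : X -> Y -> R) (P : protocol) : R :=
  \big[Rplus/0]_(a <- atoms P) \big[Rplus/0]_(x : X) \big[Rplus/0]_(y : Y)
    (let j := mu x y * a.2 x y in
     if Rle_dec j 0 then 0 else j * log2 (j / (mu x y * tprob mu a.2))).

Definition ICset (mu : X -> Y -> R) (f : X -> Y -> bool) (eta : R) : R -> Prop :=
  fun v => exists P, protocol_valid P /\ performs P f eta /\ v = ic_ext mu P.

Definition mu_prod (mu1 : X -> R) (mu2 : Y -> R) : X -> Y -> R :=
  fun x y => mu1 x * mu2 y.

Definition preim_mass (mu : X -> Y -> R) (f : X -> Y -> bool) (b : bool) : R :=
  \big[Rplus/0]_(x : X) \big[Rplus/0]_(y : Y | f x y == b) mu x y.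

Definition delta (mu : X -> Y -> R) (f : X -> Y -> bool) : R :=
  Rmin (preim_mass mu f false) (preim_mass mu f true).

End Protocols.

(* Main.v *)
Require Import Defs.
From Stdlib Require Import Reals.
From mathcomp Require Import all_boot.
From Stdlib Require Import Lra FunctionalExtensionality.
From mathcomp Require Import Rstruct.
Local Open Scope R_scope.

(* Let both parties run a zero-error protocol on inputs that each of them first
   replaces, with probability [eta = eps / 2], by a fresh sample from its marginal.
   The error is at most [2 eta], and a leaf of weight [a x * b y] gets weight
   [N a x * N b y] with [N a = (1 - eta) a + eta E a].  Because [mu] is a product, the
   information of a leaf splits into two relative entropies; convexity of [v ln v]
   makes each of them shrink by the factor [1 - eta], with an extra gain
   [eta log (1 / eta)] times the mass of [{a = 0}] (resp. [{b = 0}]).  A leaf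
   rectangle is monochromatic, so its mass is at most [1 - delta] and one of its sides
   has mass at most [sqrt (1 - delta)].
   For [delta > 0]: if [f] is constant on the support of [mu], announcing membership in
   the supports of [mu1] and [mu2], and running a zero-error protocol only when one
   of them fails, reveals nothing. *)

(** * Finite sums of reals *)

(** Membership is [List.In] because the sums run over leaves, which carry real-valued functions and
    so have no decidable equality. *)
Lemma sumR_le (I : Type) (r : seq I) (P : pred I) (F G : I -> R) :
  (forall i, List.In i r -> P i -> F i <= G i) ->
  \big[Rplus/0]_(i <- r | P i) F i <= \big[Rplus/0]_(i <- r | P i) G i.
Proof.
elim: r => [|i r IH] H; first by rewrite !big_nil; lra.
rewrite !big_cons.
have {}IH := IH (fun j Hj => H j (or_intror Hj)).
case Pi: (P i) => //.
by have := H i (or_introl erefl) Pi; lra.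
Qed.

Lemma sumR_ge0 (I : Type) (r : seq I) (P : pred I) (F : I -> R) :
  (forall i, List.In i r -> P i -> 0 <= F i) ->
  0 <= \big[Rplus/0]_(i <- r | P i) F i.
Proof. by move=> H; have := sumR_le I r P _ _ H; rewrite big1_eq. Qed.

Lemma sumR_ge_term (I : Type) (r : seq I) (P : pred I) (F : I -> R) (j : I) :
  (forall i, List.In i r -> P i -> 0 <= F i) -> List.In j r -> P j ->
  F j <= \big[Rplus/0]_(i <- r | P i) F i.
Proof.
elim: r => [//|i r IH] H [<-|jr] Pj; rewrite big_cons.
  rewrite Pj; have := @sumR_ge0 I r P F (fun k Hk => H k (or_intror Hk)); lra.
have := IH (fun k Hk => H k (or_intror Hk)) jr Pj.
case Pi: (P i) => //; have := H i (or_introl erefl) Pi; lra.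
Qed.

Lemma sumR_ge_finterm (T : finType) (P : pred T) (F : T -> R) (j : T) :
  (forall i, P i -> 0 <= F i) -> P j ->
  F j <= \big[Rplus/0]_(i | P i) F i.
Proof.
move=> H Pj; rewrite (bigD1 j) //=.
suff: 0 <= \big[Rplus/0]_(i | P i && (i != j)) F i by lra.
by apply: sumR_ge0 => i _ /andP[Pi _]; exact: H.
Qed.

Lemma sumR_pair (T U : finType) (F : T -> R) (G : U -> R) :
  \big[Rplus/0]_(x : T) \big[Rplus/0]_(y : U) (F x * G y) =
  (\big[Rplus/0]_(x : T) F x) * (\big[Rplus/0]_(y : U) G y).
Proof. by rewrite big_distrl /=; apply: eq_bigr => x _; rewrite big_distrr. Qed.

(** * Logarithms and binary entropy *)

Lemma ln_le_sub1 (v : R) : 0 < v -> ln v <= v - 1.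
Proof. by move=> v0; have := exp_ineq1_le (ln v); rewrite exp_ln //; lra. Qed.

Lemma ln2_gt0 : 0 < ln 2.
Proof. by have := ln_lt_2; lra. Qed.

Lemma log2_ln (v : R) : log2 v * ln 2 = ln v.
Proof. by rewrite /log2; field; have := ln2_gt0; lra. Qed.

Lemma log2M (u v : R) : 0 < u -> 0 < v -> log2 (u * v) = log2 u + log2 v.
Proof. by move=> u0 v0; rewrite /log2 ln_mult // /Rdiv Rmult_plus_distr_r. Qed.

Lemma log2_1 : log2 1 = 0.
Proof. by rewrite /log2 ln_1 /Rdiv Rmult_0_l. Qed.

Lemma lnV_diff (u v : R) : 0 < u -> 0 < v -> ln (u / v) = ln u - ln v.
Proof. by move=> u0 v0; rewrite ln_mult ?ln_Rinv //; exact: Rinv_0_lt_compat. Qed.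

(** Convexity of [v ln v] between [v] and [1], where it vanishes. The bound [ln u <= u - 1] is
    applied to [z / v] and to [z]; the linear terms cancel because [z] is the barycentre. *)
Lemma xlnx_convex1 (v eta : R) : 0 < v -> 0 < eta < 1 ->
  ((1 - eta) * v + eta) * ln ((1 - eta) * v + eta) <= (1 - eta) * (v * ln v).
Proof.
move=> v0 e01; set z := (1 - eta) * v + eta.
have z0 : 0 < z by rewrite /z; have := Rmult_lt_0_compat (1 - eta) v; lra.
have H1 : v * (ln z - ln v) <= z - v.
  rewrite -lnV_diff //.
  have := Rmult_le_compat_l v _ _ (Rlt_le _ _ v0) (ln_le_sub1 (z / v) (Rdiv_lt_0_compat _ _ z0 v0)).
  by have -> : v * (z / v - 1) = z - v by field; lra.
have H2 := ln_le_sub1 z z0.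
have H3 : (1 - eta) * (v * (ln z - ln v)) <= (1 - eta) * (z - v).
  by apply: Rmult_le_compat_l; lra.
have H4 : eta * ln z <= eta * (z - 1) by apply: Rmult_le_compat_l; lra.
have -> : z * ln z = (1 - eta) * (v * ln z) + eta * ln z by rewrite /z; ring.
have : (1 - eta) * (z - v) + eta * (z - 1) = 0 by rewrite /z; ring.
lra.
Qed.

Lemma hbin_ge0 (e : R) : 0 < e < 1 -> 0 <= hbin e.
Proof.
move=> e01; rewrite /hbin.
have neg v : 0 < v < 1 -> v * log2 v <= 0.
  move=> v01; rewrite /log2.
  have H : ln v <= 0 by have := ln_le_sub1 v; lra.
  have := Rmult_le_pos v (- ln v / ln 2).
  have : 0 <= - ln v / ln 2.
    by apply: Rmult_le_pos; [lra | have := Rinv_0_lt_compat _ ln2_gt0; lra].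
  move=> h1 h2; have := h2 _ h1.
  have -> : v * (- ln v / ln 2) = - (v * (ln v / ln 2)) by field; have := ln2_gt0; lra.
  lra.
have := neg e e01; have := neg (1 - e); lra.
Qed.

(** In natural logarithms, [- (1 - e) ln (1 - e) <= e <= 2 e ln 2] because [ln 2 > 1/2], and the
    remaining [- e ln e] is at most [- 2 e ln e]. *)
Lemma hbin_le_half_noise (e : R) : 0 < e < 1/2 ->
  hbin e / 4 <= - (e / 2 * log2 (e / 2)).
Proof.
move=> e01; rewrite /hbin.
have l2 := ln_lt_2.
suff : (- (e * log2 e) - (1 - e) * log2 (1 - e)) * ln 2 <= (- (2 * e * log2 (e / 2))) * ln 2.
  move/(Rmult_le_reg_r (ln 2) _ _ ln2_gt0); lra.
have -> : (- (e * log2 e) - (1 - e) * log2 (1 - e)) * ln 2 =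
  - (e * ln e) - (1 - e) * ln (1 - e) by rewrite -(log2_ln e) -(log2_ln (1 - e)); ring.
have -> : (- (2 * e * log2 (e / 2))) * ln 2 = - (2 * e * (ln e - ln 2)).
  by rewrite -lnV_diff -?(log2_ln (e / 2)); [ring | lra | lra].
have H1 : - ((1 - e) * ln (1 - e)) <= e.
  have h : - ln (1 - e) <= / (1 - e) - 1.
    rewrite -ln_Rinv; last lra.
    by apply: ln_le_sub1; apply: Rinv_0_lt_compat; lra.
  have := Rmult_le_compat_l (1 - e) _ _ _ h.
  have -> : (1 - e) * (/ (1 - e) - 1) = e by field; lra.
  lra.
have H2 : e * ln e <= 0.
  have := Rmult_le_compat_l e (ln e) 0.
  have := ln_le_sub1 e; lra.
have H3 : e <= 2 * e * ln 2.
  have := Rmult_le_compat_l (2 * e) (/ 2) (ln 2).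
  have -> : 2 * e * / 2 = e by field.
  lra.
lra.
Qed.

(** * Resampling noise and relative entropy *)

Definition mean {T : finType} (m a : T -> R) : R := \big[Rplus/0]_(z : T) (m z * a z).

(** The Markov operator of resampling: the expected value of [a] at an input kept with probability
    [1 - eta] and otherwise redrawn from [m]. *)
Definition noise {T : finType} (eta : R) (m a : T -> R) : T -> R :=
  fun x => (1 - eta) * a x + eta * mean m a.

(** Unnormalised: [mean m a] times the Kullback-Leibler divergence, in bits, from [m] of the law
    with density [a / mean m a]. *)
Definition rel_ent {T : finType} (m a : T -> R) : R :=
  \big[Rplus/0]_(x : T) (m x * a x * log2 (a x / mean m a)).

Definition suppR {T : finType} (a : T -> R) : pred T :=
  fun x => if Rlt_dec 0 (a x) then true else false.

Lemma suppRP {T : finType} (a : T -> R) (x : T) : reflect (0 < a x) (suppR a x).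
Proof. by rewrite /suppR; case: Rlt_dec => h; constructor. Qed.

Lemma mean_ge0 {T : finType} (m a : T -> R) :
  (forall x, 0 <= m x) -> (forall x, 0 <= a x) -> 0 <= mean m a.
Proof. by move=> m0 a0; apply: sumR_ge0 => x _ _; exact: Rmult_le_pos. Qed.

Lemma mean_cst {T : finType} (m : T -> R) (c : R) :
  is_dist m -> mean m (fun=> c) = c.
Proof. by case=> _ m1; rewrite /mean -big_distrl /= m1 Rmult_1_l. Qed.

Lemma mean_noise {T : finType} (eta : R) (m a : T -> R) :
  is_dist m -> mean m (noise eta m a) = mean m a.
Proof.
case=> m0 m1; rewrite /mean.
under eq_bigr do rewrite /noise Rmult_plus_distr_l.
rewrite big_split /= -big_distrl /= m1 -/(mean m a).
have -> : \big[Rplus/0]_i (m i * ((1 - eta) * a i)) = (1 - eta) * mean m a.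
  by rewrite /mean big_distrr; apply: eq_bigr => i _ /=; ring.
ring.
Qed.

Lemma noise_ge0 {T : finType} (eta : R) (m a : T -> R) (x : T) :
  0 < eta < 1 -> (forall x, 0 <= m x) -> (forall x, 0 <= a x) -> 0 <= noise eta m a x.
Proof.
move=> e01 m0 a0; rewrite /noise.
have := Rmult_le_pos (1 - eta) (a x); have := Rmult_le_pos eta (mean m a).
have := mean_ge0 m a m0 a0; have := a0 x; lra.
Qed.

Lemma noise_le {T : finType} (eta : R) (m a b : T -> R) (x : T) :
  0 < eta < 1 -> (forall x, 0 <= m x) -> (forall x, a x <= b x) ->
  noise eta m a x <= noise eta m b x.
Proof.
move=> e01 m0 ab; rewrite /noise.
have := Rmult_le_compat_l (1 - eta) _ _ _ (ab x).
have H : mean m a <= mean m b by apply: sumR_le => z _ _; exact: Rmult_le_compat_l.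
have := Rmult_le_compat_l eta _ _ _ H; lra.
Qed.

Lemma noise_sub {T : finType} (eta : R) (m a p : T -> R) (x : T) :
  noise eta m (fun z => a z * (1 - p z)) x =
  noise eta m a x - noise eta m (fun z => a z * p z) x.
Proof.
rewrite /noise.
have -> : mean m a = mean m (fun z => a z * (1 - p z)) + mean m (fun z => a z * p z).
  by rewrite /mean -big_split; apply: eq_bigr => z _ /=; ring.
ring.
Qed.

Lemma noise_cst {T : finType} (eta : R) (m : T -> R) (c : R) (x : T) :
  is_dist m -> noise eta m (fun=> c) x = c.
Proof. by move=> dm; rewrite /noise mean_cst //; ring. Qed.

(* With [v = a x / mean m a], mixing in the constant [1] is a pointwise convexity
   step for [v ln v], which gains [eta log (1/eta)] exactly where [v = 0]. *)
Lemma rel_ent_noise {T : finType} (eta : R) (m a : T -> R) :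
  is_dist m -> 0 < eta < 1 -> (forall x, 0 <= a x) ->
  rel_ent m (noise eta m a) <= (1 - eta) * rel_ent m a
    - mean m a * ((1 - \big[Rplus/0]_(x | suppR a x) m x) * - (eta * log2 eta)).
Proof.
move=> dm e01 a0; have [m0 m1] := dm.
set s := \big[Rplus/0]_(x | suppR a x) m x.
(* Spreading the missing mass over the points makes the claim a termwise inequality. *)
have -> : 1 - s = \big[Rplus/0]_x (if suppR a x then 0 else m x).
  rewrite -m1 (bigID (suppR a)) /= -/s big_mkcond /=.
  rewrite (_ : forall u v, u + v - u = v); last by move=> *; ring.
  by rewrite [LHS]big_mkcond /=; apply: eq_bigr => i _; case: (suppR a i).
rewrite /rel_ent mean_noise //; set A := mean m a.
rewrite /Rminus Ropp_mult_distr_l big_distrl /= !big_distrr /= -big_split /=.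
apply: sumR_le => x _ _.
have mA : 0 <= A := mean_ge0 m a m0 a0.
have max : m x * a x <= A.
  by apply: (@sumR_ge_finterm T xpredT (fun z => m z * a z)) => // i _; exact: Rmult_le_pos.
(* With mean zero, [m x * a x] and its noisy version vanish, so the value of the division by [A] is
   irrelevant. *)
case: (Req_dec A 0) => A0.
  have h : m x * a x = 0 by have := Rmult_le_pos _ _ (m0 x) (a0 x); lra.
  rewrite /noise -/A A0.
  have -> : m x * ((1 + - eta) * a x + eta * 0) = (1 - eta) * (m x * a x) by ring.
  by rewrite h; lra.
have Ap : 0 < A by lra.
case: suppRP => h.
  have v0 : 0 < a x / A by exact: Rdiv_lt_0_compat.
  have := xlnx_convex1 _ _ v0 e01.
  have -> : (1 - eta) * (a x / A) + eta = noise eta m a x / A by rewrite /noise -/A; field.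
  move/(Rmult_le_compat_l (m x * A / ln 2)) => H.
  have := H _; have -> : forall z, m x * A / ln 2 * (z / A * ln (z / A)) = m x * z * log2 (z / A).
    by move=> z; rewrite /log2; field; have := ln2_gt0; lra.
  have -> : m x * A / ln 2 * ((1 - eta) * (a x / A * ln (a x / A))) =
     (1 - eta) * (m x * a x * log2 (a x / A)).
    by rewrite /log2; field; have := ln2_gt0; lra.
  rewrite Rmult_0_l Rmult_0_r Rplus_0_r; apply.
  apply: Rmult_le_pos; first exact: Rmult_le_pos.
  by have := Rinv_0_lt_compat _ ln2_gt0; lra.
have ax : a x = 0 by have := a0 x; lra.
rewrite /noise -/A ax.
have -> : ((1 - eta) * 0 + eta * A) / A = eta by field.
apply: Req_le; rewrite /Rminus; ring.
Qed.

(** * Information carried by one leaf *)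

Definition rprod {X Y : finType} (a : X -> R) (b : Y -> R) : X -> Y -> R :=
  fun x y => a x * b y.

Definition leaf_info {X Y : finType} (mu w : X -> Y -> R) : R :=
  \big[Rplus/0]_(x : X) \big[Rplus/0]_(y : Y)
    (let j := mu x y * w x y in
     if Rle_dec j 0 then 0 else j * log2 (j / (mu x y * tprob mu w))).

Lemma tprob_prod {X Y : finType} (mu1 : X -> R) (mu2 : Y -> R) a b :
  tprob (mu_prod mu1 mu2) (rprod a b) = mean mu1 a * mean mu2 b.
Proof.
rewrite /tprob /mean -sumR_pair; apply: eq_bigr => x _; apply: eq_bigr => y _.
by rewrite /mu_prod /rprod; ring.
Qed.

(** For a product distribution and a rectangle weight the posterior ratio factors, so its logarithm
    is a sum; summing each term over the other player's input produces the other mean. *)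
Lemma leaf_info_prod {X Y : finType} (mu1 : X -> R) (mu2 : Y -> R) a b :
  is_dist mu1 -> is_dist mu2 -> (forall x, 0 <= a x) -> (forall y, 0 <= b y) ->
  leaf_info (mu_prod mu1 mu2) (rprod a b) =
  mean mu2 b * rel_ent mu1 a + mean mu1 a * rel_ent mu2 b.
Proof.
move=> [m0 _] [n0 _] a0 b0.
have posm (T : finType) (m c : T -> R) x : (forall x, 0 <= m x) -> (forall x, 0 <= c x) ->
    0 < m x * c x -> 0 < mean m c.
  move=> h1 h2 h3; apply: (Rlt_le_trans _ _ _ h3).
  by apply: (@sumR_ge_finterm T xpredT (fun z => m z * c z)) => // i _; exact: Rmult_le_pos.
transitivity (\big[Rplus/0]_(x : X) \big[Rplus/0]_(y : Y)
    ((mu1 x * a x * log2 (a x / mean mu1 a)) * (mu2 y * b y) +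
     (mu1 x * a x) * (mu2 y * b y * log2 (b y / mean mu2 b)))); last first.
  under eq_bigr do rewrite big_split /=.
  by rewrite big_split /= !sumR_pair /rel_ent /mean; ring.
rewrite /leaf_info tprob_prod.
apply: eq_bigr => x _; apply: eq_bigr => y _ /=; rewrite /mu_prod /rprod.
have u0 := Rmult_le_pos _ _ (m0 x) (a0 x).
have v0 := Rmult_le_pos _ _ (n0 y) (b0 y).
have E : mu1 x * mu2 y * (a x * b y) = (mu1 x * a x) * (mu2 y * b y) by ring.
rewrite E.
(* On a null entry one of the two factors is zero, which kills both terms on the right and agrees
   with the convention [0 log 0 = 0]. *)
case: Rle_dec => h /=.
  have {}h : (mu1 x * a x) * (mu2 y * b y) = 0 by have := Rmult_le_pos _ _ u0 v0; lra.
  by case: (Rmult_integral _ _ h) => ->; ring.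
have u1 : 0 < mu1 x * a x.
  by case: u0 => // u0; case: h; rewrite -u0 Rmult_0_l; lra.
have v1 : 0 < mu2 y * b y.
  by case: v0 => // v0; case: h; rewrite -v0 Rmult_0_r; lra.
have A := posm _ _ _ x m0 a0 u1; have B := posm _ _ _ y n0 b0 v1.
have pos2 p q : 0 <= p -> 0 <= q -> 0 < p * q -> 0 < p /\ 0 < q.
  move=> p0 q0 pq; split; first by case: p0 => // p0; move: pq; rewrite -p0 Rmult_0_l; lra.
  by case: q0 => // q0; move: pq; rewrite -q0 Rmult_0_r; lra.
have [m1 a1] := pos2 _ _ (m0 x) (a0 x) u1.
have [n1 b1] := pos2 _ _ (n0 y) (b0 y) v1.
have -> : mu1 x * a x * (mu2 y * b y) / (mu1 x * mu2 y * (mean mu1 a * mean mu2 b)) =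
   (a x / mean mu1 a) * (b y / mean mu2 b) by field; lra.
rewrite log2M; [ring | exact: Rdiv_lt_0_compat | exact: Rdiv_lt_0_compat].
Qed.

Lemma supp_mass_le1 {T : finType} (m : T -> R) (P : pred T) :
  is_dist m -> 0 <= \big[Rplus/0]_(x | P x) m x <= 1.
Proof.
case=> m0 m1; split; first by apply: sumR_ge0 => x _ _.
rewrite -m1 [X in _ <= X](bigID P) /=.
have := @sumR_ge0 T (index_enum T) (fun x => ~~ P x) m (fun x _ _ => m0 x); lra.
Qed.

Lemma preim_massD {X Y : finType} (mu1 : X -> R) (mu2 : Y -> R) f :
  is_dist mu1 -> is_dist mu2 ->
  preim_mass (mu_prod mu1 mu2) f false + preim_mass (mu_prod mu1 mu2) f true = 1.
Proof.
move=> [_ m1] [_ n1]; rewrite /preim_mass -big_split /=.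
rewrite -[RHS]Rmult_1_l -[X in _ = X * _]m1 -[X in _ = _ * X]n1 -sumR_pair; apply: eq_bigr => x _.
rewrite [RHS](bigID (fun y => f x y == false)) /=; congr (_ + _).
by apply: eq_bigl => y; case: (f x y).
Qed.

(** The rectangle lies in one preimage of [f], and the other preimage has mass at least [delta]. *)
Lemma monochromatic_mass {X Y : finType} (mu1 : X -> R) (mu2 : Y -> R) f
    (P : pred X) (Q : pred Y) c :
  is_dist mu1 -> is_dist mu2 -> (forall x y, P x -> Q y -> f x y = c) ->
  (\big[Rplus/0]_(x | P x) mu1 x) * (\big[Rplus/0]_(y | Q y) mu2 y)
    <= 1 - delta (mu_prod mu1 mu2) f.
Proof.
move=> dm dn fc; have [m0 _] := dm; have [n0 _] := dn.
apply: (Rle_trans _ (preim_mass (mu_prod mu1 mu2) f c)).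
  rewrite [X in X * _ <= _]big_mkcond [X in _ * X <= _]big_mkcond -sumR_pair.
  apply: sumR_le => x _ _; rewrite [X in _ <= X]big_mkcond /=; apply: sumR_le => y _ _.
  have pq := Rmult_le_pos _ _ (m0 x) (n0 y); rewrite /mu_prod.
  have := fc x y; case: (P x); case: (Q y) => h; case: eqP => e; try lra.
  by case: e; apply: h.
have := preim_massD mu1 mu2 f dm dn; rewrite /delta.
by have := Rmin_l (preim_mass (mu_prod mu1 mu2) f false) (preim_mass (mu_prod mu1 mu2) f true);
  have := Rmin_r (preim_mass (mu_prod mu1 mu2) f false) (preim_mass (mu_prod mu1 mu2) f true);
  case: c {fc} => *; lra.
Qed.

(** The smaller of [s] and [t] is at most [sqrt d], since its square is at most [s * t]; the other
    is at most 1. *)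
Lemma one_sub_sqrt_le (s t d : R) : 0 <= s <= 1 -> 0 <= t <= 1 -> 0 <= d ->
  s * t <= d -> 1 - sqrt d <= (1 - s) + (1 - t).
Proof.
move=> s01 t01 d0 std; have q0 := sqrt_pos d; have qq := sqrt_sqrt d d0.
case: (Rle_lt_dec (s + t) (1 + sqrt d)) => [|h]; first by lra.
have := Rmult_le_pos (s - sqrt d) (t - sqrt d); nra.
Qed.

(** Noise preserves means, so the splitting into two relative entropies keeps its coefficients. The
    two gains add up to [mean a * mean b * ((1 - s) + (1 - t)) * k], where [s], [t] are the masses
    of the sides; the mass bound and [hbin eps / 4 <= k] finish. *)
Lemma leaf_info_noise {X Y : finType} (mu1 : X -> R) (mu2 : Y -> R) f a b c eps :
  is_dist mu1 -> is_dist mu2 -> (forall x, 0 <= a x) -> (forall y, 0 <= b y) ->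
  (forall x y, 0 < a x -> 0 < b y -> f x y = c) -> 0 < eps < 1/2 ->
  leaf_info (mu_prod mu1 mu2) (rprod (noise (eps / 2) mu1 a) (noise (eps / 2) mu2 b)) <=
  (1 - eps / 2) * leaf_info (mu_prod mu1 mu2) (rprod a b) -
  (1 - sqrt (1 - delta (mu_prod mu1 mu2) f)) / 4 * hbin eps *
    tprob (mu_prod mu1 mu2) (rprod a b).
Proof.
move=> dm dn a0 b0 fc e01; have [m0 _] := dm; have [n0 _] := dn.
have e1 : 0 < eps / 2 < 1 by lra.
rewrite tprob_prod !leaf_info_prod // ?mean_noise //; try by move=> ?; exact: noise_ge0.
have Ea := rel_ent_noise _ _ _ dm e1 a0; have Eb := rel_ent_noise _ _ _ dn e1 b0.
have A := mean_ge0 _ _ m0 a0; have B := mean_ge0 _ _ n0 b0.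
have {Ea}Ea := Rmult_le_compat_l _ _ _ B Ea.
have {Eb}Eb := Rmult_le_compat_l _ _ _ A Eb.
set s := \big[Rplus/0]_(x | suppR a x) mu1 x in Ea.
set t := \big[Rplus/0]_(x | suppR b x) mu2 x in Eb.
have s01 : 0 <= s <= 1 by exact: supp_mass_le1.
have t01 : 0 <= t <= 1 by exact: supp_mass_le1.
set d := 1 - delta _ _.
have st : s * t <= d.
  by apply: (monochromatic_mass _ _ _ _ _ c) => // x y /suppRP ? /suppRP ?; exact: fc.
have d0 : 0 <= d by have := Rmult_le_pos s t; lra.
have q := one_sub_sqrt_le _ _ _ s01 t01 d0 st.
set k := - (eps / 2 * log2 (eps / 2)) in Ea Eb.
have hk := hbin_le_half_noise eps e01; rewrite -/k in hk.
have h0 : 0 <= hbin eps by apply: hbin_ge0; lra.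
have AB := Rmult_le_pos _ _ A B.
have : (1 - sqrt d) / 4 * hbin eps <= ((1 - s) + (1 - t)) * k by nra.
move/(Rmult_le_compat_l _ _ _ AB); nra.
Qed.

(** * Rectangles of a protocol tree and the resampled tree *)

(** The rectangle property made explicit: each leaf keeps one weight per player, accumulated from
    the root down, in the order of [leaves]. *)
Fixpoint rects {X Y : finType} (a : X -> R) (b : Y -> R) (t : ptree X Y) :
    seq (bool * ((X -> R) * (Y -> R))) :=
  match t with
  | PLeaf c => [:: (c, (a, b))]
  | PAlice p t0 t1 =>
      rects (fun x => a x * (1 - p x)) b t0 ++ rects (fun x => a x * p x) b t1
  | PBob q t0 t1 =>
      rects a (fun y => b y * (1 - q y)) t0 ++ rects a (fun y => b y * q y) t1
  end.

(** A conditional probability. The default 0 covers histories of probability zero, where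
    [0 <= v <= u] forces [v = 0]. *)
Definition ratio (u v : R) : R := if Rlt_dec 0 u then v / u else 0.

Lemma ratioK (u v : R) : 0 <= v <= u -> u * ratio u v = v.
Proof. by rewrite /ratio => h; case: Rlt_dec => u0 /=; [field; lra | lra]. Qed.

Lemma ratio01 (u v : R) : 0 <= v <= u -> 0 <= ratio u v <= 1.
Proof.
rewrite /ratio => h; case: Rlt_dec => u0 /=; last lra.
have i0 := Rinv_0_lt_compat _ u0.
split; first by apply: Rmult_le_pos; lra.
apply: (Rmult_le_reg_r u) => //; rewrite /Rdiv Rmult_assoc Rinv_l; lra.
Qed.

(* Running [t] on independently resampled inputs, with the resampling deferred:
   [a] and [b] are the reach weights of the current node in the original tree, and
   each party sends the next bit with its conditional probability given its own
   input and the history. *)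
Fixpoint resampled {X Y : finType} (eta : R) (mu1 : X -> R) (mu2 : Y -> R)
    (a : X -> R) (b : Y -> R) (t : ptree X Y) : ptree X Y :=
  match t with
  | PLeaf c => PLeaf X Y c
  | PAlice p t0 t1 =>
      PAlice (fun x => ratio (noise eta mu1 a x) (noise eta mu1 (fun z => a z * p z) x))
        (resampled eta mu1 mu2 (fun x => a x * (1 - p x)) b t0)
        (resampled eta mu1 mu2 (fun x => a x * p x) b t1)
  | PBob q t0 t1 =>
      PBob (fun y => ratio (noise eta mu2 b y) (noise eta mu2 (fun z => b z * q z) y))
        (resampled eta mu1 mu2 a (fun y => b y * (1 - q y)) t0)
        (resampled eta mu1 mu2 a (fun y => b y * q y) t1)
  end.

(** [leaves] multiplies probabilities from the leaf upwards and [rects] from the root downwards;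
    arbitrary starting weights let the induction pass. *)
Lemma leaves_rects {X Y : finType} (t : ptree X Y) a b :
  [seq (l.1.2, fun x y => a x * b y * l.2 x y) | l <- leaves t] =
  [seq (r.1, rprod r.2.1 r.2.2) | r <- rects a b t].
Proof.
elim: t a b => [c|p t0 IH0 t1 IH1|p t0 IH0 t1 IH1] a b /=.
- congr [:: (_, _)]; do 2 apply: functional_extensionality => ?.
  by rewrite Rmult_1_r.
- rewrite !map_cat -IH0 -IH1 -!map_comp; congr (_ ++ _); apply: eq_map => l /=;
    congr (_, _); do 2 apply: functional_extensionality => ?; ring.
- rewrite !map_cat -IH0 -IH1 -!map_comp; congr (_ ++ _); apply: eq_map => l /=;
    congr (_, _); do 2 apply: functional_extensionality => ?; ring.
Qed.

Lemma noise_step {T : finType} (eta : R) (m a p : T -> R) (x : T) :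
  0 < eta < 1 -> (forall x, 0 <= m x) -> (forall x, 0 <= a x) ->
  (forall x, 0 <= p x <= 1) ->
  0 <= noise eta m (fun z => a z * p z) x <= noise eta m a x.
Proof.
move=> e01 m0 a0 p01; split.
  by apply: noise_ge0 => // z; apply: Rmult_le_pos; [|case: (p01 z)].
by apply: noise_le => // z; have := a0 z; have := p01 z; nra.
Qed.

Lemma mul_unit_ge0 {T : finType} (a p : T -> R) :
  (forall x, 0 <= a x) -> (forall x, 0 <= p x <= 1) ->
  (forall x, 0 <= a x * p x) /\ (forall x, 0 <= a x * (1 - p x)).
Proof. by move=> a0 p01; split=> x; have := a0 x; have := p01 x; nra. Qed.

Lemma rects_ge0 {X Y : finType} (t : ptree X Y) a b :
  ptree_valid t -> (forall x, 0 <= a x) -> (forall y, 0 <= b y) ->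
  forall r, List.In r (rects a b t) -> (forall x, 0 <= r.2.1 x) /\ (forall y, 0 <= r.2.2 y).
Proof.
elim: t a b => [c|p t0 IH0 t1 IH1|p t0 IH0 t1 IH1] a b /=.
- by move=> _ a0 b0 r [<-|[]].
- move=> [p01 [v0 v1]] a0 b0 r; have [h1 h2] := mul_unit_ge0 _ _ a0 p01.
  by case/(List.in_app_or _ _ _); [apply: IH0 | apply: IH1].
- move=> [p01 [v0 v1]] a0 b0 r; have [h1 h2] := mul_unit_ge0 _ _ b0 p01.
  by case/(List.in_app_or _ _ _); [apply: IH0 | apply: IH1].
Qed.

Lemma resampled_valid {X Y : finType} eta mu1 mu2 (t : ptree X Y) a b :
  is_dist mu1 -> is_dist mu2 -> 0 < eta < 1 ->
  ptree_valid t -> (forall x, 0 <= a x) -> (forall y, 0 <= b y) ->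
  ptree_valid (resampled eta mu1 mu2 a b t).
Proof.
move=> [m0 _] [n0 _] e01.
elim: t a b => [c|p t0 IH0 t1 IH1|p t0 IH0 t1 IH1] a b //= [p01 [v0 v1]] a0 b0.
- have [h1 h2] := mul_unit_ge0 _ _ a0 p01.
  split; first by move=> x; apply: ratio01; exact: noise_step.
  by split; [apply: IH0 | apply: IH1].
- have [h1 h2] := mul_unit_ge0 _ _ b0 p01.
  split; first by move=> x; apply: ratio01; exact: noise_step.
  by split; [apply: IH0 | apply: IH1].
Qed.

(** Each bit probability is a quotient of consecutive noisy weights, so the product along a path
    telescopes to the noisy weight of the leaf. The 0-branch uses linearity of [noise], through
    [noise_sub]. *)
Lemma leaves_resampled {X Y : finType} eta mu1 mu2 (t : ptree X Y) a b :
  is_dist mu1 -> is_dist mu2 -> 0 < eta < 1 ->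
  ptree_valid t -> (forall x, 0 <= a x) -> (forall y, 0 <= b y) ->
  [seq (l.1.2, fun x y => noise eta mu1 a x * noise eta mu2 b y * l.2 x y)
     | l <- leaves (resampled eta mu1 mu2 a b t)] =
  [seq (r.1, rprod (noise eta mu1 r.2.1) (noise eta mu2 r.2.2)) | r <- rects a b t].
Proof.
move=> [m0 _] [n0 _] e01.
elim: t a b => [c|p t0 IH0 t1 IH1|p t0 IH0 t1 IH1] a b /=.
- move=> _ _ _; congr [:: (_, _)]; do 2 apply: functional_extensionality => ?.
  by rewrite Rmult_1_r.
- move=> [p01 [v0 v1]] a0 b0; have [h1 h2] := mul_unit_ge0 _ _ a0 p01.
  rewrite !map_cat -IH0 // -IH1 // -!map_comp; congr (_ ++ _); apply: eq_map => l /=;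
    congr (_, _); apply: functional_extensionality => x; apply: functional_extensionality => y.
  + rewrite noise_sub -{2}(ratioK _ _ (noise_step eta mu1 a p x e01 m0 a0 p01)); ring.
  + rewrite -{2}(ratioK _ _ (noise_step eta mu1 a p x e01 m0 a0 p01)); ring.
- move=> [p01 [v0 v1]] a0 b0; have [h1 h2] := mul_unit_ge0 _ _ b0 p01.
  rewrite !map_cat -IH0 // -IH1 // -!map_comp; congr (_ ++ _); apply: eq_map => l /=;
    congr (_, _); apply: functional_extensionality => x; apply: functional_extensionality => y.
  + rewrite noise_sub -{2}(ratioK _ _ (noise_step eta mu2 b p y e01 n0 b0 p01)); ring.
  + rewrite -{2}(ratioK _ _ (noise_step eta mu2 b p y e01 n0 b0 p01)); ring.
Qed.

(** * From trees to protocols with public randomness *)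

(** The probability of the public string is absorbed into Alice's initial weight; being constant, it
    is unchanged by noise. *)
Definition prects {X Y : finType} (P : protocol X Y) :=
  flatten [seq rects (fun=> c.1) (fun=> 1) c.2 | c <- P].

Definition resampled_protocol {X Y : finType} eta mu1 mu2 (P : protocol X Y) : protocol X Y :=
  [seq (c.1, resampled eta mu1 mu2 (fun=> c.1) (fun=> 1) c.2) | c <- P].

(** Error and information cost depend only on the outputs and weights of transcripts, so the
    transcript labels can be forgotten. *)
Lemma map_atoms {X Y : finType} (P : protocol X Y) :
  [seq (z.1.2, z.2) | z <- atoms P] =
  flatten [seq [seq (l.1.2, fun x y => c.1 * l.2 x y) | l <- leaves c.2] | c <- P].
Proof.
rewrite /atoms map_flatten -map_comp /=; congr flatten.
under eq_map => r do rewrite /= -map_comp.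
rewrite -[in RHS](mkseq_nth (0, PLeaf X Y false) P) /mkseq -map_comp.
by apply: eq_map => r /=; apply: eq_map.
Qed.

Lemma protocol_validP {X Y : finType} (P : protocol X Y) :
  protocol_valid P <->
  (forall c, List.In c P -> 0 <= c.1 /\ ptree_valid c.2) /\ \big[Rplus/0]_(c <- P) c.1 = 1.
Proof.
rewrite /protocol_valid big_map; split.
  move=> [h1 [h2 h3]]; split=> // c /(@List.In_nth _ _ _ (0, PLeaf X Y false)) [n [/ltP np <-]].
  have E : List.nth n P (0, PLeaf X Y false) = nth (0, PLeaf X Y false) P n.
    by elim: P n {h1 h2 h3 np} => [|? ? IH] [|n] //=.
  by rewrite E; split; [exact: h1 | exact: h3].
move=> [h1 h2].
have In_nth r : (r < size P)%N -> List.In (nth (0, PLeaf X Y false) P r) P.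
  elim: P r {h1 h2} => [|c P IH] [|r] //= rP; [by left | right; exact: IH].
by split; [|split] => // r /In_nth /h1 [].
Qed.

Lemma atoms_prects {X Y : finType} (P : protocol X Y) :
  [seq (z.1.2, z.2) | z <- atoms P] = [seq (r.1, rprod r.2.1 r.2.2) | r <- prects P].
Proof.
rewrite map_atoms /prects map_flatten -map_comp; congr flatten.
apply: eq_map => c /=; rewrite -leaves_rects; apply: eq_map => l.
by congr (_, _); do 2 apply: functional_extensionality => ?; rewrite Rmult_1_r.
Qed.

Lemma eq_map_In (I J : Type) (F G : I -> J) (r : seq I) :
  (forall i, List.In i r -> F i = G i) -> map F r = map G r.
Proof.
elim: r => //= i r IH H; rewrite H ?IH //; last by left.
by move=> j jr; apply: H; right.
Qed.

Lemma atoms_resampled {X Y : finType} eta mu1 mu2 (P : protocol X Y) :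
  is_dist mu1 -> is_dist mu2 -> 0 < eta < 1 -> protocol_valid P ->
  [seq (z.1.2, z.2) | z <- atoms (resampled_protocol eta mu1 mu2 P)] =
  [seq (r.1, rprod (noise eta mu1 r.2.1) (noise eta mu2 r.2.2)) | r <- prects P].
Proof.
move=> dm dn e01 /protocol_validP [vP _].
rewrite map_atoms /prects map_flatten /resampled_protocol -!map_comp; congr flatten.
apply: eq_map_In => c /vP [c0 vc] /=.
rewrite -leaves_resampled //; last by move=> ?; lra.
apply: eq_map => l; congr (_, _).
by apply: functional_extensionality => x; apply: functional_extensionality => y;
  rewrite !noise_cst //; ring.
Qed.

Lemma resampled_protocol_valid {X Y : finType} eta mu1 mu2 (P : protocol X Y) :
  is_dist mu1 -> is_dist mu2 -> 0 < eta < 1 -> protocol_valid P ->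
  protocol_valid (resampled_protocol eta mu1 mu2 P).
Proof.
move=> dm dn e01 /protocol_validP [vP s1]; apply/protocol_validP.
rewrite /resampled_protocol big_map; split=> // c /(List.in_map_iff _ _ _) [d [<- /vP [d0 vd]]] /=.
by split=> //; apply: resampled_valid => // ?; lra.
Qed.

Lemma rects_total {X Y : finType} (t : ptree X Y) a b x y :
  \big[Rplus/0]_(r <- rects a b t) (r.2.1 x * r.2.2 y) = a x * b y.
Proof.
elim: t a b => [c|p t0 IH0 t1 IH1|p t0 IH0 t1 IH1] a b /=.
- by rewrite big_seq1.
- by rewrite big_cat IH0 IH1 /=; ring.
- by rewrite big_cat IH0 IH1 /=; ring.
Qed.

Lemma prects_total {X Y : finType} (P : protocol X Y) x y : protocol_valid P ->
  \big[Rplus/0]_(r <- prects P) (r.2.1 x * r.2.2 y) = 1.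
Proof.
move=> /protocol_validP [_ <-]; rewrite /prects big_flatten big_map /=.
by apply: eq_bigr => c _; rewrite rects_total Rmult_1_r.
Qed.

Lemma prects_ge0 {X Y : finType} (P : protocol X Y) : protocol_valid P ->
  forall r, List.In r (prects P) -> (forall x, 0 <= r.2.1 x) /\ (forall y, 0 <= r.2.2 y).
Proof.
move=> /protocol_validP [vP _] r; rewrite /prects.
elim: P vP => //= c P IH vP /(List.in_app_or _ _ _) [|]; last first.
  by apply: IH => d dP; apply: vP; right.
have [c0 vc] := vP c (or_introl erefl).
by apply: rects_ge0 => // ?; lra.
Qed.

Lemma big_atoms {X Y : finType} (P : protocol X Y) (Q : bool -> bool) (F : (X -> Y -> R) -> R) :
  \big[Rplus/0]_(z <- atoms P | Q z.1.2) F z.2 =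
  \big[Rplus/0]_(z <- [seq (z.1.2, z.2) | z <- atoms P] | Q z.1) F z.2.
Proof. by rewrite big_map. Qed.

Lemma atoms_total {X Y : finType} (P : protocol X Y) x y : protocol_valid P ->
  \big[Rplus/0]_(z <- atoms P) z.2 x y = 1.
Proof.
move=> vP; rewrite (big_atoms P xpredT (fun w => w x y)) atoms_prects big_map /=.
exact: prects_total.
Qed.

(** * Error and information cost of the resampled protocol *)

Lemma perr_prects {X Y : finType} (P : protocol X Y) f x y :
  perr P f x y = \big[Rplus/0]_(r <- prects P | r.1 != f x y) (r.2.1 x * r.2.2 y).
Proof.
by rewrite /perr (big_atoms P (fun c => c != f x y) (fun w => w x y)) atoms_prects big_map.
Qed.

Lemma performs0_monochromatic {X Y : finType} (P : protocol X Y) f :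
  protocol_valid P -> performs P f 0 ->
  forall r, List.In r (prects P) -> forall x y, 0 < r.2.1 x -> 0 < r.2.2 y -> f x y = r.1.
Proof.
move=> vP pf r rP x y ax bY; case: (f x y =P r.1) => // /eqP ne; exfalso.
have := pf x y; rewrite perr_prects => le0.
rewrite eq_sym in ne.
have ge0 i : List.In i (prects P) -> i.1 != f x y -> 0 <= i.2.1 x * i.2.2 y.
  by move=> /(prects_ge0 _ vP) [a0 b0] _; exact: Rmult_le_pos.
by have := sumR_ge_term _ _ _ _ _ ge0 rP ne; have := Rmult_lt_0_compat _ _ ax bY; lra.
Qed.

(** Both inputs are kept with probability [(1 - eta)^2 >= 1 - 2 eta]. In weights: [noise] of [a] is
    at least [(1 - eta) a], so correct leaves retain that fraction of their mass. *)
Lemma resampled_performs {X Y : finType} eta mu1 mu2 (P : protocol X Y) f :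
  is_dist mu1 -> is_dist mu2 -> 0 < eta < 1 -> protocol_valid P -> performs P f 0 ->
  performs (resampled_protocol eta mu1 mu2 P) f (2 * eta).
Proof.
move=> dm dn e01 vP pf x y; have [m0 _] := dm; have [n0 _] := dn.
have vP' := resampled_protocol_valid eta mu1 mu2 P dm dn e01 vP.
have := atoms_total _ x y vP'.
rewrite (bigID (fun z => z.1.2 != f x y)) /= -/(perr _ f x y).
have := prects_total _ x y vP.
rewrite (bigID (fun r => r.1 != f x y)) /= -perr_prects.
rewrite (big_atoms _ (fun c => ~~ (c != f x y)) (fun w => w x y)) atoms_resampled // big_map /=.
set good := (X in _ + X = 1 -> _); set good' := (X in _ -> _ + X = 1 -> _).
have : (1 - eta) * (1 - eta) * good <= good'.
  rewrite /good big_distrr /=; apply: sumR_le => r /(prects_ge0 _ vP) [a0 b0] _.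
  rewrite /rprod /noise.
  have A := mean_ge0 _ _ m0 a0; have B := mean_ge0 _ _ n0 b0.
  have ax := a0 x; have bY := b0 y.
  rewrite (_ : _ * _ * _ = ((1 - eta) * r.2.1 x) * ((1 - eta) * r.2.2 y)); last ring.
  have hA := Rmult_le_pos eta _ _ A; have hB := Rmult_le_pos eta _ _ B.
  by apply: Rmult_le_compat; try (apply: Rmult_le_pos; lra); lra.
move=> le1 e2 e3; have le0 := pf x y.
(* Zero error of [P] puts all the mass at [(x, y)] on correct leaves. *)
have g1 : 1 <= good by lra.
have := Rmult_le_compat_l ((1 - eta) * (1 - eta)) _ _ _ g1; nra.
Qed.

Lemma ic_ext_leaf_info {X Y : finType} mu (P : protocol X Y) :
  ic_ext mu P = \big[Rplus/0]_(z <- [seq (z.1.2, z.2) | z <- atoms P]) leaf_info mu z.2.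
Proof. by rewrite big_map. Qed.

Lemma ic_ext_resampled {X Y : finType} mu1 mu2 (P : protocol X Y) f eps :
  is_dist mu1 -> is_dist mu2 -> 0 < eps < 1/2 -> protocol_valid P -> performs P f 0 ->
  ic_ext (mu_prod mu1 mu2) (resampled_protocol (eps / 2) mu1 mu2 P) <=
  (1 - eps / 2) * ic_ext (mu_prod mu1 mu2) P -
  (1 - sqrt (1 - delta (mu_prod mu1 mu2) f)) / 4 * hbin eps.
Proof.
move=> dm dn e01 vP pf; have [m0 m1] := dm; have [n0 n1] := dn.
rewrite !ic_ext_leaf_info atoms_resampled //; last lra.
rewrite atoms_prects !big_map /=; set K := _ / 4 * hbin eps.
(* Transcript probabilities sum to 1, so the leafwise gains [K * tprob] add up to exactly [K]. *)
have tot : \big[Rplus/0]_(r <- prects P) tprob (mu_prod mu1 mu2) (rprod r.2.1 r.2.2) = 1.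
  rewrite /tprob exchange_big /=; under eq_bigr do rewrite exchange_big /=.
  rewrite -[RHS]Rmult_1_l -[X in _ = X * _]m1 -[X in _ = _ * X]n1 -sumR_pair.
  apply: eq_bigr => x _; apply: eq_bigr => y _.
  by rewrite -big_distrr /= prects_total // Rmult_1_r.
rewrite -[X in _ <= _ - X]Rmult_1_r -[X in _ <= _ - K * X]tot /Rminus Ropp_mult_distr_l !big_distrr /= -big_split /=.
apply: sumR_le => r rP _; have [a0 b0] := prects_ge0 _ vP _ rP.
have := leaf_info_noise _ _ f _ _ r.1 eps dm dn a0 b0 (performs0_monochromatic _ _ vP pf _ rP) e01.
by rewrite -/K -/(1 - eps / 2); lra.
Qed.

(** * Positivity of [delta] *)

(** Both copies of [t] are reached only off the support of [mu]: they keep the output correct on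
    null inputs, where zero error is still demanded, at no information cost. *)
Definition guarded {X Y : finType} (mu1 : X -> R) (mu2 : Y -> R) (c : bool)
    (t : ptree X Y) : ptree X Y :=
  PAlice (fun x => if suppR mu1 x then 1 else 0) t
    (PBob (fun y => if suppR mu2 y then 1 else 0) t (PLeaf X Y c)).

Definition guarded_protocol {X Y : finType} mu1 mu2 c (P : protocol X Y) : protocol X Y :=
  [seq (d.1, guarded mu1 mu2 c d.2) | d <- P].

Lemma guarded_protocol_valid {X Y : finType} mu1 mu2 c (P : protocol X Y) :
  protocol_valid P -> protocol_valid (guarded_protocol mu1 mu2 c P).
Proof.
move=> /protocol_validP [vP s1]; apply/protocol_validP.
rewrite /guarded_protocol big_map; split=> // d /(List.in_map_iff _ _ _) [e [<- /vP [e0 ve]]] /=.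
split=> //; split; first by move=> x; case: suppR; lra.
by split=> //; split=> // y; case: suppR; lra.
Qed.

Lemma big_atoms_tree {X Y : finType} (P : protocol X Y) (F : bool -> (X -> Y -> R) -> R) :
  \big[Rplus/0]_(z <- atoms P) F z.1.2 z.2 =
  \big[Rplus/0]_(d <- P) \big[Rplus/0]_(l <- leaves d.2) F l.1.2 (fun x y => d.1 * l.2 x y).
Proof.
transitivity (\big[Rplus/0]_(z <- [seq (z.1.2, z.2) | z <- atoms P]) F z.1 z.2).
  by rewrite big_map.
rewrite map_atoms big_flatten big_map; apply: eq_bigr => d _.
by rewrite big_map.
Qed.

Lemma perr_tree {X Y : finType} (P : protocol X Y) f x y :
  perr P f x y = \big[Rplus/0]_(d <- P) \big[Rplus/0]_(l <- leaves d.2)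
    (if l.1.2 != f x y then d.1 * l.2 x y else 0).
Proof.
rewrite /perr big_mkcond.
exact: (big_atoms_tree P (fun b w => if b != f x y then w x y else 0)).
Qed.

Lemma guarded_perr {X Y : finType} mu1 mu2 c (P : protocol X Y) f x y :
  (0 < mu1 x -> 0 < mu2 y -> f x y = c) ->
  perr (guarded_protocol mu1 mu2 c P) f x y =
  (if suppR mu1 x && suppR mu2 y then 0 else perr P f x y).
Proof.
move=> fc; rewrite !perr_tree big_map /=.
(* The copies of [d.2] are reached under disjoint conditions, so together they count once off the
   supports and not at all on them; the last term is the constant leaf. *)
have E (d : R * ptree X Y) : \big[Rplus/0]_(l <- leaves (guarded mu1 mu2 c d.2))
      (if l.1.2 != f x y then d.1 * l.2 x y else 0) =
    (if suppR mu1 x && suppR mu2 y then 0 else 1) *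
      \big[Rplus/0]_(l <- leaves d.2) (if l.1.2 != f x y then d.1 * l.2 x y else 0) +
    (if suppR mu1 x && suppR mu2 y && (c != f x y) then d.1 else 0).
  rewrite /= !big_cat /= !map_cat !big_cat /= -!map_comp !big_map big_seq1 /= -?map_comp ?big_map.
  rewrite -Rplus_assoc; congr (_ + _).
    rewrite -big_split big_distrr /=; apply: eq_bigr => l _.
    by case: (l.1.2 != f x y); case: (suppR mu1 x); case: (suppR mu2 y) => /=; ring.
  by case: (c != f x y); case: (suppR mu1 x); case: (suppR mu2 y) => /=; ring.
under eq_bigr do rewrite E.
case: suppRP => h1; case: suppRP => h2 /=.
- rewrite fc // eqxx /=; under eq_bigr do rewrite Rmult_0_l Rplus_0_l.
  by rewrite big1_eq.
- by apply: eq_bigr => d _; ring.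
- by apply: eq_bigr => d _; ring.
- by apply: eq_bigr => d _; ring.
Qed.

Lemma leaf_info_null {X Y : finType} (mu w : X -> Y -> R) :
  (forall x y, mu x y * w x y = 0) -> leaf_info mu w = 0.
Proof.
move=> h; rewrite /leaf_info big1 // => x _; rewrite big1 // => y _ /=.
by rewrite h; case: Rle_dec => // h0; exfalso; lra.
Qed.

(** Up to null inputs the weight is the constant [c], independent of the inputs, so every logarithm
    that counts is [log2 1]. *)
Lemma leaf_info_supp_cst {X Y : finType} mu1 mu2 c :
  is_dist mu1 -> is_dist mu2 ->
  leaf_info (mu_prod mu1 mu2) (rprod (fun x : X => c * if suppR mu1 x then 1 else 0)
                                (fun y : Y => if suppR mu2 y then 1 else 0)) = 0.
Proof.
move=> dm dn; have [m0 _] := dm; have [n0 _] := dn.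
have mult (T : finType) (m : T -> R) d x : (forall x, 0 <= m x) ->
    m x * (d * if suppR m x then 1 else 0) = m x * d.
  move=> h; case: suppRP => h1; first by ring.
  by have -> : m x = 0 by [have := h x; lra]; ring.
have mean1 (T : finType) (m : T -> R) d : is_dist m ->
    mean m (fun x => d * if suppR m x then 1 else 0) = d.
  move=> dd; rewrite -[RHS](mean_cst m d dd); apply: eq_bigr => x _.
  by apply: mult; case: dd.
rewrite /leaf_info tprob_prod mean1 //.
have -> : mean mu2 (fun y => if suppR mu2 y then 1 else 0) = 1.
  rewrite -[RHS](mean1 _ mu2 1 dn); apply: eq_bigr => y _; ring.
rewrite big1 // => x _; rewrite big1 // => y _ /=.
case: Rle_dec => //= h.
have E : mu_prod mu1 mu2 x y * rprod (fun x => c * (if suppR mu1 x then 1 else 0))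
    (fun y => if suppR mu2 y then 1 else 0) x y = mu_prod mu1 mu2 x y * (c * 1).
  rewrite /mu_prod /rprod.
  have := mult _ mu1 c x m0; have := mult _ mu2 1 y n0.
  rewrite Rmult_1_l => h1 h2.
  transitivity ((mu1 x * (c * (if suppR mu1 x then 1 else 0))) *
    (mu2 y * (if suppR mu2 y then 1 else 0))); first by ring.
  by rewrite h1 h2; ring.
rewrite E in h *; rewrite Rdiv_diag; last by lra.
by rewrite log2_1 Rmult_0_r.
Qed.

Lemma guarded_ic_ext {X Y : finType} mu1 mu2 c (P : protocol X Y) :
  is_dist mu1 -> is_dist mu2 ->
  ic_ext (mu_prod mu1 mu2) (guarded_protocol mu1 mu2 c P) = 0.
Proof.
move=> dm dn; have [m0 _] := dm; have [n0 _] := dn.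
rewrite [LHS](big_atoms_tree _ (fun=> leaf_info (mu_prod mu1 mu2))) big_map big1 // => d _ /=.
rewrite !big_cat /= !map_cat !big_cat /= -!map_comp !big_map big_seq1 /=.
have null (T : finType) (m : T -> R) x : (forall x, 0 <= m x) ->
    m x * (1 - if suppR m x then 1 else 0) = 0.
  move=> h; case: suppRP => h1; first by ring.
  by have -> : m x = 0 by [have := h x; lra]; ring.
rewrite !big1.
- rewrite -[RHS](leaf_info_supp_cst (X := X) (Y := Y) mu1 mu2 d.1 dm dn) !Rplus_0_l.
  congr leaf_info; do 2 apply: functional_extensionality => ?; rewrite /rprod; ring.
- move=> l _; apply: leaf_info_null => x y; rewrite /mu_prod /=.
  transitivity (mu2 y * (1 - if suppR mu2 y then 1 else 0) *
    (mu1 x * d.1 * (if suppR mu1 x then 1 else 0) * l.2 x y)); first by ring.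
  by rewrite null //; ring.
- move=> l _; apply: leaf_info_null => x y; rewrite /mu_prod /=.
  transitivity (mu1 x * (1 - if suppR mu1 x then 1 else 0) *
    (mu2 y * d.1 * l.2 x y)); first by ring.
  by rewrite null //; ring.
Qed.

Lemma preim_mass_gt0 {X Y : finType} (mu1 : X -> R) (mu2 : Y -> R) f I0 c :
  is_dist mu1 -> is_dist mu2 ->
  is_inf (ICset (mu_prod mu1 mu2) f 0) I0 -> 0 < I0 ->
  0 < preim_mass (mu_prod mu1 mu2) f c.
Proof.
move=> dm dn [lb glb] I0p; have [m0 _] := dm; have [n0 _] := dn.
case: (Rlt_le_dec 0 (preim_mass (mu_prod mu1 mu2) f c)) => // le0; exfalso.
have fnc x y : 0 < mu1 x -> 0 < mu2 y -> f x y = ~~ c.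
  move=> mx ny; case: (f x y =P c) => [e|/eqP]; last by case: c {le0} (f x y) => [] [].
  have := Rmult_lt_0_compat _ _ mx ny.
  have h : mu_prod mu1 mu2 x y <= preim_mass (mu_prod mu1 mu2) f c.
    apply: (Rle_trans _ (\big[Rplus/0]_(y | f x y == c) mu_prod mu1 mu2 x y)).
      by apply: sumR_ge_finterm => [z _|]; [exact: Rmult_le_pos | exact/eqP].
    apply: (@sumR_ge_finterm X xpredT (fun x => \big[Rplus/0]_(y | f x y == c) mu_prod mu1 mu2 x y)) => // z _.
    by apply: sumR_ge0 => w _ _; exact: Rmult_le_pos.
  by rewrite -[mu1 x * mu2 y]/(mu_prod mu1 mu2 x y); lra.
(* Any zero-error protocol would yield a guarded one of cost 0, against [I0 > 0]. Hence the set of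
   costs is empty and [I0 + 1] is also a lower bound, which contradicts that [I0] is the
   greatest. *)
suff : I0 + 1 <= I0 by lra.
apply: glb => v [P [vP [pf _]]]; exfalso.
have : I0 <= 0; last by lra.
apply: lb; exists (guarded_protocol mu1 mu2 (~~ c) P); split; first exact: guarded_protocol_valid.
split; last by rewrite guarded_ic_ext.
move=> x y; rewrite guarded_perr; last exact: fnc.
by case: (_ && _); [lra | exact: pf].
Qed.

(** * Passage to the infima *)

Theorem theorem14 (X Y : finType) (mu1 : X -> R) (mu2 : Y -> R)
  (f : X -> Y -> bool) (I0 : R) :
  is_dist mu1 -> is_dist mu2 ->
  is_inf (ICset (mu_prod mu1 mu2) f 0) I0 -> 0 < I0 ->
  0 < delta (mu_prod mu1 mu2) f /\
  (forall eps Ieps : R, 0 < eps < 1/2 ->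
     is_inf (ICset (mu_prod mu1 mu2) f eps) Ieps ->
     I0 - Ieps >= (1 - sqrt (1 - delta (mu_prod mu1 mu2) f)) / 4 * hbin eps
                  + eps / 2 * I0).
Proof.
move=> dm dn inf0 I0p; split.
  by rewrite /delta; apply: Rmin_glb_lt; apply: preim_mass_gt0 inf0 I0p.
move=> eps Ieps e01 [lbe _]; have [_ glb] := inf0.
set K := _ / 4 * hbin eps.
have e1 : 0 < eps / 2 < 1 by lra.
have q0 : 0 < 1 - eps / 2 by lra.
(* The infimum [I0] need not be attained, so the inequality is solved for the zero-error cost: the
   left side is a lower bound for every zero-error protocol. Multiplying back by [1 - eps / 2]
   yields the [eps / 2 * I0] term. *)
have : (Ieps + K) / (1 - eps / 2) <= I0.
  apply: glb => v [P [vP [pf ->]]].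
  have vP' := resampled_protocol_valid (eps / 2) mu1 mu2 P dm dn e1 vP.
  have pf' := resampled_performs (eps / 2) mu1 mu2 P f dm dn e1 vP pf.
  rewrite (_ : 2 * (eps / 2) = eps) in pf'; last by field.
  have le := lbe _ (ex_intro _ _ (conj vP' (conj pf' erefl))).
  have := ic_ext_resampled mu1 mu2 P f eps dm dn e01 vP pf; rewrite -/K => le'.
  apply: (Rmult_le_reg_r (1 - eps / 2)) => //.
  rewrite /Rdiv Rmult_assoc Rinv_l; lra.
move/(Rmult_le_compat_r _ _ _ (Rlt_le _ _ q0)).
rewrite /Rdiv Rmult_assoc Rinv_l; lra.
Qed.
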